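(* Let $G=K_m+\overline{K_n}$ be the complete split graph, i.e. the join of the complete graph $K_m$ and the edgeless graph $\overline{K_n}$ on $n$ vertices, with $n\ge 2$. Then $\operatorname{nim}(\mathrm{DNT}(G))=\operatorname{pty}(m)$ and $\operatorname{nim}(\mathrm{TER}(G))=1+\operatorname{pty}(m)$.
   Context: Graphs are finite and simple with nonempty vertex set. The join of two graphs is their disjoint union together with all edges between the two vertex sets. For a graph $G$ with vertex set $V$, a set $K\subseteq V$ is convex if it contains every vertex lying on any shortest path between two elements of $K$. The convex hull $[P]$ of $P\subseteq V$ is the smallest convex set containing $P$. For an integer $k$, $\operatorname{pty}(k):=k\bmod 2\in\{0,1\}$. The game $\mathrm{DNT}(G)$: positions are the sets $P\subseteq V$ with $[V\setminus P]=V$; the starting position is $\emptyset$; the options of $P$ are the sets $P\cup\{v\}$ with $v\in V\setminus P$ and $[V\setminus(P\cup\{v\})]=V$. The game $\mathrm{TER}(G)$: positions are the sets $P\subseteq V$ reachable from the starting position $\emptyset$ by the following moves. If $[V\setminus P]=V$, then the options of $P$ are all sets $P\cup\{v\}$ with $v\in V\setminus P$; if $[V\setminus P]\neq V$, then $P$ is terminal (has no options). The nim-value of a position is defined recursively by $\operatorname{nim}(p)=\operatorname{mex}\{\operatorname{nim}(q): q\text{ an option of }p\}$, where $\operatorname{mex}(A)$ is the smallest nonnegative integer not in $A$; the nim-value of a game is that of its starting position. *)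

(* Defs.v *)
From mathcomp Require Import all_boot.
From Stdlib Require Import Wf_nat.

Set Implicit Arguments.
Unset Strict Implicit.
Unset Printing Implicit Defensive.

(** * Finite simple graphs *)

Record sgraph := SGraph {
  vertex :> finType;
  adj : rel vertex;
  adj_sym : symmetric adj;
  adj_irrefl : irreflexive adj }.

Section CompleteEdgeless.
Variable n : nat.

Definition complete_adj (x y : 'I_n) : bool := x != y.
Lemma complete_sym : symmetric complete_adj.
Proof. by move=> x y; rewrite /complete_adj eq_sym. Qed.
Lemma complete_irrefl : irreflexive complete_adj.
Proof. by move=> x; rewrite /complete_adj eqxx. Qed.
Definition complete : sgraph := SGraph complete_sym complete_irrefl.

Definition edgeless_adj (x y : 'I_n) : bool := false.
Lemma edgeless_sym : symmetric edgeless_adj. Proof. by []. Qed.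
Lemma edgeless_irrefl : irreflexive edgeless_adj. Proof. by []. Qed.
Definition edgeless : sgraph := SGraph edgeless_sym edgeless_irrefl.
End CompleteEdgeless.

Section Join.
Variables G H : sgraph.

Definition join_adj (x y : G + H) : bool :=
  match x, y with
  | inl a, inl b => adj a b
  | inr a, inr b => adj a b
  | _, _ => true
  end.
Lemma join_sym : symmetric join_adj.
Proof. by move=> [x|x] [y|y] //=; rewrite adj_sym. Qed.
Lemma join_irrefl : irreflexive join_adj.
Proof. by move=> [x|x] /=; rewrite adj_irrefl. Qed.
Definition join : sgraph := SGraph join_sym join_irrefl.
End Join.

(** * Geodesic convexity *)

Section Convexity.
Variable G : sgraph.

(* [p] lists the vertices of the path after its first vertex [x], so that
   [size p] is the length of the path. *)
Definition is_path (x y : G) (p : seq G) : bool :=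
  [&& path (@adj G) x p, uniq (x :: p) & last x p == y].

Definition shortest_path (x y : G) (p : seq G) : bool :=
  is_path x y p &&
  [forall n : 'I_(size p), forall q : n.-tuple G, ~~ is_path x y q].

(* Paths have fewer than [#|G|] edges, so the bound on [n] excludes nothing;
   see [convexP]. *)
Definition convex (K : {set G}) : bool :=
  [forall x in K, forall y in K, forall n : 'I_#|G|, forall p : n.-tuple G,
     shortest_path x y p ==> all (mem K) (x :: p)].

Definition hull (P : {set G}) : {set G} :=
  \bigcap_(K : {set G} | convex K && (P \subset K)) K.

Lemma shortest_pathP x y p :
  reflect (is_path x y p /\ forall q, is_path x y q -> size p <= size q)
          (shortest_path x y p).
Proof.
apply: (iffP andP) => -[pathp minp]; split=> //.
  move=> q pathq; rewrite leqNgt; apply/negP => ltqp.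
  have /forallP/(_ (in_tuple q)) := forallP minp (Ordinal ltqp).
  by rewrite pathq.
apply/forallP => n; apply/forallP => q; apply/negP => /minp.
by rewrite size_tuple leqNgt ltn_ord.
Qed.

Lemma convexP (K : {set G}) :
  reflect (forall x y z p, x \in K -> y \in K -> shortest_path x y p ->
             z \in x :: p -> z \in K)
          (convex K).
Proof.
apply: (iffP idP) => [cK x y z p Kx Ky sp | cK].
  have ltp : size p < #|G|.
    have /shortest_pathP[/and3P[_ up _] _] := sp.
    by rewrite -[(size p).+1]/(size (x :: p)) -(card_uniqP up) max_card.
  have /forall_inP/(_ _ Kx)/forall_inP/(_ _ Ky)/forallP/(_ (Ordinal ltp)) := cK.
  by move=> /forallP/(_ (in_tuple p))/implyP/(_ sp)/allP; apply.
apply/forall_inP => x Kx; apply/forall_inP => y Ky.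
apply/forallP => n; apply/forallP => p; apply/implyP => sp.
by apply/allP => z; apply: cK sp.
Qed.

Lemma hull_min (P K : {set G}) : convex K -> P \subset K -> hull P \subset K.
Proof. by move=> cK sPK; apply: bigcap_inf; rewrite cK. Qed.

Lemma sub_hull (P : {set G}) : P \subset hull P.
Proof. by apply/bigcapsP => K /andP[]. Qed.

Lemma convex_hull (P : {set G}) : convex (hull P).
Proof.
apply/convexP => x y z p /bigcapP hx /bigcapP hy sp zp.
by apply/bigcapP => K PK; have /andP[/convexP cK _] := PK; apply: cK sp zp; auto.
Qed.

Lemma hull_setT : hull setT = setT.
Proof. by apply/eqP; rewrite -subTset sub_hull. Qed.

End Convexity.

(** * Finite impartial games and nim-values *)

Lemma mex_subproof (s : seq nat) : exists n, n \notin s.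
Proof.
exists (\max_(i <- s) i).+1; apply/negP => ms.
have := @leq_bigmax_seq _ s xpredT id _ ms isT.
by rewrite /= ltnn.
Qed.

Definition mex (s : seq nat) : nat := ex_minn (mex_subproof s).

(* [option p q] means that [q] is an option of [p]. *)
Record game := Game {
  position : finType;
  start : position;
  option : rel position;
  option_wf : well_founded (fun q p => option p q) }.

Section Nim.
Variable A : game.

Definition nim_step (p : position A)
    (rec : forall q : position A, option p q -> nat) : nat :=
  mex [seq rec (val q) (valP q) | q : {q : position A | option p q}].

Definition nim_pos : position A -> nat :=
  Fix (@option_wf A) (fun=> nat) nim_step.

Lemma nim_posE (p : position A) :
  nim_pos p = mex [seq nim_pos q | q in option p].
Proof.
rewrite /nim_pos Fix_eq; last first.
  by move=> x f g fg; congr mex; apply: eq_map => q; apply: fg.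
rewrite -/nim_pos /nim_step /mex.
apply: eq_ex_minn => n; congr negb; apply/imageP/imageP => -[q qp ->].
  by exists (val q); first exact: valP.
by exists (exist _ q qp).
Qed.

End Nim.

Definition nim (A : game) : nat := nim_pos (start A).

(** * The games DNT and TER *)

Section Games.
Variable G : sgraph.

Definition spans (P : {set G}) : bool := hull (~: P) == setT.

Lemma spans0 : spans set0.
Proof. by rewrite /spans setC0 hull_setT. Qed.

Definition adds_vertex (P Q : {set G}) : bool :=
  [exists v : G, (v \notin P) && (Q == v |: P)].

Lemma sub_adds_vertex_wf (T : Type) (f : T -> {set G}) (r : rel T) :
  (forall p q, r p q -> adds_vertex (f p) (f q)) ->
  well_founded (fun q p => r p q).
Proof.
move=> sub_r; apply: (@well_founded_lt_compat _ (fun p => #|~: f p|)) => q p.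
move=> /sub_r/existsP[v /andP[vp /eqP ->]]; apply/ltP.
rewrite proper_card // properC; apply/properP; split; first exact: subsetUr.
by exists v; rewrite ?setU11.
Qed.

Definition DNT_position := {P : {set G} | spans P}.
Definition DNT_option (P Q : DNT_position) : bool :=
  adds_vertex (val P) (val Q).
Definition DNT : game :=
  Game (exist _ set0 spans0 : DNT_position)
       (sub_adds_vertex_wf (f := val) (r := DNT_option) (fun _ _ => id)).

Definition TER_move (P Q : {set G}) : bool := spans P && adds_vertex P Q.

Definition TER_position := {P : {set G} | connect TER_move set0 P}.
Definition TER_option (P Q : TER_position) : bool := TER_move (val P) (val Q).
Definition TER : game :=
  Game (exist _ set0 (connect0 TER_move set0) : TER_position)
       (sub_adds_vertex_wf (f := val) (r := TER_option)
          (fun _ _ PQ => proj2 (andP PQ))).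

End Games.

Definition pty (k : nat) : nat := k %% 2.

(* Main.v *)
(** Every vertex of the edgeless part is simplicial, so its complement is convex; conversely two
    nonadjacent vertices together with all their common neighbours span the join. Hence [V \ P]
    spans exactly when [P] lies in the clique. In DNT the players then just exhaust the [m] clique
    vertices; in TER every nonterminal position has in addition a move to a terminal position, of
    value 0, which shifts all the nim-values by one. *)
Require Import Defs.
From mathcomp Require Import all_boot.

Set Implicit Arguments.
Unset Strict Implicit.
Unset Printing Implicit Defensive.

Lemma mex_eq (s : seq nat) k :
  k \notin s -> (forall i, i < k -> i \in s) -> mex s = k.
Proof.
move=> ks lts; rewrite /mex; case: ex_minnP => i is_ mini.
apply/eqP; rewrite eqn_leq mini //= leqNgt.
by apply: contra is_; apply: lts.
Qed.

Lemma nim_pos_eq (A : game) (p : position A) k :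
  (forall q, option p q -> nim_pos q != k) ->
  (forall i, i < k -> exists2 q, option p q & nim_pos q = i) ->
  nim_pos p = k.
Proof.
move=> neqk ltk; rewrite nim_posE; apply: mex_eq => [|i /ltk[q pq <-]].
  by apply/imageP => -[q /neqk/eqP neq eq]; apply: neq.
by apply/imageP; exists q.
Qed.

Lemma ptyS k : pty k.+1 = 1 - pty k.
Proof. by rewrite /pty !modn2 /=; case: odd. Qed.

Lemma pty_le1 k : pty k <= 1.
Proof. by rewrite /pty modn2 leq_b1. Qed.

Lemma cardsD_setU1 (T : finType) (C P : {set T}) v :
  v \in C -> v \notin P -> #|C :\: P| = #|C :\: (v |: P)|.+1.
Proof. by move=> vC vP; rewrite (cardsD1 v) !inE vC vP setDDl setUC. Qed.

Section SpanningComplement.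
Variables (G : sgraph) (C : {set G}).
(** This is all that the two nim-value computations need to know about convexity in [G]. *)
Hypothesis spansE : forall P : {set G}, spans P = (P \subset C).

(** Every move uses up one vertex of [C], so all options have the opposite parity, and an option
    exists as long as [C :\: val p] is nonempty. *)
Lemma nim_pos_DNT (p : position (DNT G)) :
  nim_pos p = pty #|C :\: val p|.
Proof.
have [k] := ubnP #|C :\: val p|; elim: k p => // k IHk p ltk.
have valC (q : position (DNT G)) : val q \subset C by rewrite -spansE (valP q).
have optE q : option p q -> #|C :\: val p| = #|C :\: val q|.+1.
  move=> /existsP[v /andP[vp /eqP qE]]; rewrite qE (@cardsD_setU1 _ C _ v) //.
  by apply: (subsetP (valC q)); rewrite qE setU11.
apply: nim_pos_eq => [q pq | i lti].
  move: (optE q pq) ltk => ->; rewrite ltnS => /IHk ->.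
  by rewrite ptyS; case: pty (pty_le1 #|C :\: val q|) => [|[]].
have [C0|[v]] := set_0Vmem (C :\: val p); first by rewrite C0 cards0 in lti.
rewrite inE => /andP[vp vC].
have sv : spans (v |: val p) by rewrite spansE subUset sub1set vC valC.
pose q : position (DNT G) := exist _ (v |: val p) sv.
have pq : option p q by apply/existsP; exists v; rewrite vp eqxx.
exists q => //; move: (optE q pq) ltk lti => ->; rewrite ltnS => /IHk ->.
(* As [i] is below a parity, it is 0 and the count at [p] is odd; the count at [q] is then even. *)
by rewrite ptyS; case: pty (pty_le1 #|C :\: val q|) i => [|[]] // _ [].
Qed.

Lemma nim_DNT : nim (DNT G) = pty #|C|.
Proof. by rewrite /nim nim_pos_DNT /= setD0. Qed.

Lemma nim_pos_TER_terminal (p : position (TER G)) :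
  ~~ (val p \subset C) -> nim_pos p = 0.
Proof.
by move=> pC; apply: nim_pos_eq => // q;
  rewrite /= /TER_option /TER_move spansE (negPf pC). Qed.

Hypothesis CT : C != setT.

(** Leaving [C] gives an option of value 0. By induction, the options inside [C] all have value
    [2 - pty #|C :\: val p|], so the mex is 1 or 2 according to parity. *)
Lemma nim_pos_TER (p : position (TER G)) :
  val p \subset C -> nim_pos p = 1 + pty #|C :\: val p|.
Proof.
have [k] := ubnP #|C :\: val p|; elim: k p => // k IHk p ltk pC.
have move_to v : v \notin val p -> exists2 q, option p q & val q = v |: val p.
  move=> vp; have pq : TER_move (val p) (v |: val p).
    by rewrite /TER_move spansE pC; apply/existsP; exists v; rewrite vp eqxx.
  by exists (exist _ (v |: val p) (connect_trans (valP p) (connect1 pq))).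
have optE q : option p q -> val q \subset C ->
    nim_pos q = 1 + pty #|C :\: val q| /\ #|C :\: val p| = #|C :\: val q|.+1.
  move=> /andP[_ /existsP[v /andP[vp /eqP qE]]] qC.
  have cE : #|C :\: val p| = #|C :\: val q|.+1.
    by rewrite qE (@cardsD_setU1 _ C _ v) // (subsetP qC) // qE setU11.
  by split=> //; apply: IHk => //; rewrite -ltnS -cE.
apply: nim_pos_eq => [q pq | [_|i lti]].
- have [qC|/nim_pos_TER_terminal-> //] := boolP (val q \subset C).
  have [-> ->] := optE q pq qC.
  by rewrite ptyS; case: pty (pty_le1 #|C :\: val q|) => [|[]].
(* Value 0 is reached by adding a vertex outside [C], which ends the game. *)
- have [v vC] : exists v, v \notin C.
    apply/existsP; rewrite -negb_forall; apply: contra CT => /forallP h.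
    by apply/eqP/setP => v; rewrite h inE.
  have [|q pq qE] := move_to v; first by apply: contra vC; apply: subsetP.
  by exists q; rewrite ?nim_pos_TER_terminal // qE subUset sub1set (negPf vC).
(* The only other value to reach is 1, when the count is odd; any move inside [C] does it. *)
have [C0|[v]] := set_0Vmem (C :\: val p); first by rewrite C0 cards0 in lti.
rewrite inE => /andP[/move_to[q pq qE] vC]; exists q => //.
have [|-> cE] := optE q pq; first by rewrite qE subUset sub1set vC.
move: lti; rewrite cE ptyS.
by case: pty (pty_le1 #|C :\: val q|) i => [|[]] // _ [].
Qed.

Lemma nim_TER : nim (TER G) = 1 + pty #|C|.
Proof. by rewrite /nim nim_pos_TER /= ?setD0 ?sub0set. Qed.

End SpanningComplement.

(** A path through [u] between other vertices can skip [u], because its two neighbours on the path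
    are adjacent; hence it is not shortest. *)
Lemma convex_setC1 (G : sgraph) (u : G) :
  (forall a b : G, adj a u -> adj u b -> a != b -> adj a b) ->
  convex (~: [set u]).
Proof.
move=> simplicial_u; apply/convexP => x y z p.
rewrite !inE => xu yu /shortest_pathP[/and3P[pathp uniqp /eqP lastp] minp].
move=> /predU1P[-> //|zp]; apply: contraNneq yu => zu.
move: zp; rewrite {z}zu => /splitPr defp.
(* If nothing follows [u], then [u] is the endpoint [y]. Otherwise [last x p1] and [b] are the
   neighbours of [u] on the path. *)
case: defp pathp uniqp lastp minp => p1 [|b p2]; first by rewrite last_cat /= => _ _ ->.
rewrite cat_path last_cat /= => /and4P[path1 au ub path2] uniqp lastp minp.
have sub : subseq (x :: p1 ++ b :: p2) (x :: p1 ++ u :: b :: p2).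
  by rewrite /= eqxx; apply: cat_subseq => //; apply: subseq_cons.
have ab : last x p1 != b.
  move: (uniqp : uniq ((x :: p1) ++ _)); rewrite cat_uniq.
  move=> /and3P[_ /norP[_ /norP[+ _]] _].
  by apply: contraNneq => <-; apply: mem_last.
suff /minp : is_path x y (p1 ++ b :: p2) by rewrite !size_cat /= addnS ltnn.
by rewrite /is_path (subseq_uniq sub) // cat_path last_cat /= path1 simplicial_u //
  path2 lastp eqxx.
Qed.

Lemma shortest_path2 (G : sgraph) (x y z : G) :
  x != y -> ~~ adj x y -> adj x z -> adj z y -> shortest_path x y [:: z; y].
Proof.
move=> xy nxy xz zy; have neq (a b : G) : adj a b -> a != b.
  by apply: contraTneq => ->; rewrite adj_irrefl.
apply/shortest_pathP; split.
  by rewrite /is_path /= xz zy !inE negb_or xy (neq _ _ xz) (neq _ _ zy) eqxx.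
move=> [|a [|b q]] //; rewrite /is_path /=; first by rewrite (negPf xy).
by case/and3P=> /andP[xa _] _ /eqP ay; rewrite -ay xa in nxy.
Qed.

Section CompleteSplit.
Variables m n : nat.
Local Notation G := (join (complete m) (edgeless n)).

Definition clique_part : {set G} := [set inl a | a : 'I_m].

Lemma inr_clique_part i : (inr i : G) \notin clique_part.
Proof. by apply/imsetP => -[]. Qed.

Lemma card_clique_part : #|clique_part| = m.
Proof. by rewrite card_imset ?card_ord // => a b []. Qed.

Lemma spans_complete_split (P : {set G}) :
  2 <= n -> spans P = (P \subset clique_part).
Proof.
move=> n2; apply/eqP/idP => [hullP | /subsetP PC].
  apply/subsetP => -[a _|i iP]; first exact: imset_f.
  have cK : convex (~: [set (inr i : G)]).
    (* All neighbours of [inr i] are in the clique, hence pairwise adjacent. *)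
    apply: convex_setC1 => -[a|a] [b|b] //.
  have := hull_min cK (_ : ~: P \subset _); rewrite setCS sub1set => /(_ iP).
  by rewrite hullP => /subsetP/(_ (inr i)); rewrite !inE eqxx => /(_ isT).
have inr_hull i : (inr i : G) \in hull (~: P).
  apply: (subsetP (sub_hull _)); rewrite inE.
  by apply: contra (inr_clique_part i); apply: PC.
apply/setP => -[a|i]; rewrite [RHS]inE; last exact: inr_hull.
(* Vertices 0 and 1 of the edgeless part exist by [n2]; each [inl a] is the midpoint of a shortest
   path between them. *)
pose i : 'I_n := Ordinal (ltnW n2); pose j : 'I_n := Ordinal n2.
apply: (convexP _ (convex_hull (~: P)) (inr i) (inr j) _ [:: inl a; inr j]) => //.
  exact: shortest_path2.
by rewrite !inE eqxx orbT.
Qed.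

End CompleteSplit.

Theorem proposition4p6 (m n : nat) (hm : 1 <= m) (hn : 2 <= n) :
  nim (DNT (join (complete m) (edgeless n))) = pty m /\
  nim (TER (join (complete m) (edgeless n))) = 1 + pty m.
Proof.
have spansE P := @spans_complete_split m n P hn.
rewrite (nim_DNT spansE) (nim_TER spansE) ?card_clique_part //.
apply: contraNneq (inr_clique_part m (Ordinal hn)) => ->.
exact: in_setT.
Qed.
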